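(* Let $G$ be a group acting on a small category $A$. The diagonal $dN_c(G\rtimes A)$ of the cleaved nerve of the splitting fibration $G\rtimes A\to G$ can be regarded as a twisted cartesian product between the nerves of $A$ and $G$, namely $NA\times_\tau NG$; that is, for some twisting function $\tau$ it is isomorphic, as a simplicial set, to the twisted cartesian product $NA\times_\tau NG$ with fibre $NA$, base $NG$ and group the constant simplicial group $G$.
   Context: The group $G$ is regarded as a category with one object $\ast$. An action of $G$ on $A$ is a group morphism $G\to\mathrm{Aut}(A)$, $g\mapsto u_g$, equivalently a functor $G\to\mathrm{Cat}$ (to the category of small categories) sending the unique object to $A$. $G\rtimes A$ is the Grothendieck construction of this functor: its objects are the objects of $A$, an arrow $x\to x'$ is a pair $(f,g)$ with $g\in G$ and $f:u_g(x)\to x'$ in $A$, and $(f',g')\circ(f,g)=(f'u_{g'}(f),g'g)$. It is equipped with the projection to $G$, which is a fibration (see below), and with the closed cleavage consisting of the arrows $(\mathrm{id},g)$. For a small category $C$, $NC$ denotes its nerve, the simplicial set whose $n$-simplices are the chains $c_0\to\dots\to c_n$ of $n$ composable arrows of $C$. For a functor $p:E\to B$ of small categories, an arrow $f:e\to e'$ of $E$ is cartesian if for every $g:e\to e''$ with $p(g)=p(f)$ there is a unique $h:e'\to e''$ with $p(h)=\mathrm{id}_{p(e')}$ and $hf=g$. The functor $p$ is a fibration if for every object $e$ of $E$ and every arrow $\phi:p(e)\to b$ of $B$ there is a cartesian arrow with domain $e$ over $\phi$ (i.e. mapped to $\phi$), and cartesian arrows are closed under composition. A cleavage is a set $\Sigma$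 of cartesian arrows containing the identities and such that for each $e$ and $\phi:p(e)\to b$ there is a unique arrow in $\Sigma$ with domain $e$ over $\phi$; it is closed if closed under composition, and a fibration admitting a closed cleavage is called splitting. A cleaved map between fibrations with cleavage $(p:E\to B,\Sigma)$ and $(p':E'\to B',\Sigma')$ is a pair of functors $f:E\to E'$, $g:B\to B'$ with $p'f=gp$, $f$ preserving cartesian arrows, and $f(\Sigma)\subset\Sigma'$. Let $\underline n=\{0<\dots<n\}$, viewed as a category, and $\square_{m,n}$ the fibration $\mathrm{pr}_2:\underline m\times\underline n\to\underline n$ with its unique cleavage $\{(\mathrm{id},\alpha)\}$. The cleaved nerve $N_cE$ is the bisimplicial set whose $(m,n)$-simplices are the cleaved maps from $\square_{m,n}$ to $(p:E\to B,\Sigma)$, with structure maps given by precomposition; $d$ denotes the diagonal simplicial set, whose $n$-simplices are the $(n,n)$-simplices. The constant simplicial group $G$ (every face and degeneracy operator is the identity) operates on $NA$ from the left by $g\cdot(a_0\to\dots\to a_n)=(u_g(a_0)\to\dots\to u_g(a_n))$. Twisted cartesian product: given simplicial sets $K$ and $L$ and a simplicial group $\Gamma$ operating on $K$ from the left (i.e. a simplicial map $\Gamma\times K\to K$ that is a left group action in each degree), a twisted cartesian product $K\times_\tau L$ with fibre $K$, base $L$ and group $\Gamma$ is a simplicial set with $(K\times_\tau L)_n=K_n\times L_n$, $s_i(a,b)=(s_ia,s_ib)$ for $i\ge0$, $d_i(a,b)=(d_ia,d_ib)$ for $i>0$ and $d_0(a,b)=(\tau(b)\cdot d_0a,d_0b)$.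 Here $\tau:L_n\to\Gamma_{n-1}$, called the twisting function, is a function that must satisfy the standard identities that make this a simplicial set. *)

(* Defs.v *)
From HB Require Import structures.
From mathcomp Require Import all_boot.
From mathcomp Require Import boolp.
From mathcomp Require Import zify.

Set Implicit Arguments.
Unset Strict Implicit.
Unset Printing Implicit Defensive.

Local Open Scope nat_scope.

(** Fibrations, cleavages and actions are strict notions: they compare objects
    for equality, and arrows whose endpoints agree only propositionally.  The
    arrows of a category are therefore gathered in a single type, with source
    and target maps, so that each of these equations can be stated without
    transport.  [comp g f e] is the composite "g after f". *)

Record category := Category {
  ob : Type;
  ar : Type;
  src : ar -> ob;
  tgt : ar -> ob;
  idn : ob -> ar;
  comp : forall g f : ar, tgt f = src g -> ar;
  src_idn : forall x, src (idn x) = x;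
  tgt_idn : forall x, tgt (idn x) = x;
  src_comp : forall g f e, src (@comp g f e) = src f;
  tgt_comp : forall g f e, tgt (@comp g f e) = tgt g;
  comp_idl : forall f e, @comp (idn (tgt f)) f e = f;
  comp_idr : forall f e, @comp f (idn (src f)) e = f;
  comp_assoc : forall h g f e1 e2 e3 e4,
    @comp h (@comp g f e1) e2 = @comp (@comp h g e3) f e4 }.

Arguments idn {c} x.
Arguments comp {c} g f e.

Definition is_comp (C : category) (g f k : ar C) : Prop :=
  exists e : tgt f = src g, comp g f e = k.

Lemma comp_eq (C : category) (g g' f f' : ar C) e e' :
  g = g' -> f = f' -> comp g f e = comp g' f' e'.
Proof. by move=> gE fE; subst; congr comp; exact: Prop_irrelevance. Qed.

Lemma comp_idn (C : category) (x : ob C) (g f : ar C) e :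
  g = idn x -> f = idn x -> comp g f e = idn x.
Proof.
move=> gE fE; have e' : tgt f = src (idn (tgt f)) by rewrite src_idn.
rewrite -[RHS]fE -[RHS](comp_idl e'); apply: comp_eq => //.
by rewrite gE fE tgt_idn.
Qed.

Record functor (C D : category) := Functor {
  fob :> ob C -> ob D;
  far : ar C -> ar D;
  far_src : forall f, src (far f) = fob (src f);
  far_tgt : forall f, tgt (far f) = fob (tgt f);
  far_idn : forall x, far (idn x) = idn (fob x);
  far_comp : forall g f e e', far (comp g f e) = comp (far g) (far f) e' }.

Arguments far {C D} F f : rename.

Lemma functor_ext (C D : category) (F F' : functor C D) :
  fob F =1 fob F' -> far F =1 far F' -> F = F'.
Proof.
case: F F' => [o a p1 p2 p3 p4] [o' a' q1 q2 q3 q4] /= /funext oE /funext aE.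
by subst; congr Functor; exact: Prop_irrelevance.
Qed.

Section FunctorComp.
Variables (C D E : category) (H : functor D E) (F : functor C D).

Lemma fcomp_src f : src (far H (far F f)) = H (F (src f)).
Proof. by rewrite !far_src. Qed.
Lemma fcomp_tgt f : tgt (far H (far F f)) = H (F (tgt f)).
Proof. by rewrite !far_tgt. Qed.
Lemma fcomp_idn x : far H (far F (idn x)) = idn (H (F x)).
Proof. by rewrite !far_idn. Qed.
Lemma fcomp_comp g f e e' :
  far H (far F (comp g f e)) = comp (far H (far F g)) (far H (far F f)) e'.
Proof.
have e1 : tgt (far F f) = src (far F g) by rewrite far_src far_tgt e.
by rewrite (@far_comp _ _ F g f e e1) (@far_comp _ _ H _ _ e1 e').
Qed.

Definition fcomp : functor C E := Functor fcomp_src fcomp_tgt fcomp_idn fcomp_comp.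
End FunctorComp.

Definition fid (C : category) : functor C C.
Proof.
apply: (@Functor C C id id) => // g f e e'; exact: comp_eq.
Defined.

Lemma fcompA (C D E E' : category) (K : functor E E') (H : functor D E)
  (F : functor C D) : fcomp K (fcomp H F) = fcomp (fcomp K H) F.
Proof. exact: functor_ext. Qed.

Lemma fcomp1f (C D : category) (F : functor C D) : fcomp (fid D) F = F.
Proof. exact: functor_ext. Qed.

Lemma fcompf1 (C D : category) (F : functor C D) : fcomp F (fid C) = F.
Proof. exact: functor_ext. Qed.

Section Product.
Variables C D : category.

Definition prod_comp (g f : ar C * ar D)
    (e : (tgt f.1, tgt f.2) = (src g.1, src g.2)) : ar C * ar D :=
  (comp g.1 f.1 (congr1 fst e), comp g.2 f.2 (congr1 snd e)).

Definition prodcat : category.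
Proof.
apply: (@Category (ob C * ob D) (ar C * ar D)
  (fun f => (src f.1, src f.2)) (fun f => (tgt f.1, tgt f.2))
  (fun x => (idn x.1, idn x.2)) prod_comp).
- by case=> x y; rewrite /= !src_idn.
- by case=> x y; rewrite /= !tgt_idn.
- by move=> g f e; rewrite /= !src_comp.
- by move=> g f e; rewrite /= !tgt_comp.
- by case=> f1 f2 e; rewrite /prod_comp /= !comp_idl.
- by case=> f1 f2 e; rewrite /prod_comp /= !comp_idr.
- move=> h g f e1 e2 e3 e4; rewrite /prod_comp /=.
  by congr pair; exact: comp_assoc.
Defined.

Definition pr2 : functor prodcat D.
Proof.
apply: (@Functor prodcat D snd snd) => //= g f e e'; exact: comp_eq.
Defined.
End Product.

Definition fprod (C C' D D' : category) (F : functor C C') (H : functor D D') :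
  functor (prodcat C D) (prodcat C' D').
Proof.
apply: (@Functor (prodcat C D) (prodcat C' D') (fun x => (F x.1, H x.2))
  (fun f => (far F f.1, far H f.2))) => /=.
- by move=> f; rewrite !far_src.
- by move=> f; rewrite !far_tgt.
- by move=> x; rewrite !far_idn.
- by move=> g f e e'; rewrite /prod_comp /=; congr pair; exact: far_comp.
Defined.

Record ordarrow n := OrdArrow {
  oa_src : 'I_n.+1;
  oa_tgt : 'I_n.+1;
  oa_le : oa_src <= oa_tgt }.

Lemma ordarrow_ext n (a b : ordarrow n) :
  oa_src a = oa_src b -> oa_tgt a = oa_tgt b -> a = b.
Proof.
case: a b => [i j p] [i' j' q] /= ii jj; subst i' j'.
by congr OrdArrow; exact: bool_irrelevance.
Qed.

Lemma ord_comp_le n (g f : ordarrow n) :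
  oa_tgt f = oa_src g -> oa_src f <= oa_tgt g.
Proof. by case: g f => [i j ij] [k l kl] /= e; subst; exact: leq_trans ij. Qed.

Definition ordcat (n : nat) : category.
Proof.
apply: (@Category 'I_n.+1 (ordarrow n) (@oa_src n) (@oa_tgt n)
  (fun i => OrdArrow (leqnn i)) (fun g f e => OrdArrow (ord_comp_le e))) => //=.
- by move=> f e; exact: ordarrow_ext.
- by move=> f e; exact: ordarrow_ext.
- by move=> h g f e1 e2 e3 e4; exact: ordarrow_ext.
Defined.

Lemma functor_ordcat_ext C n (F F' : functor C (ordcat n)) :
  fob F =1 fob F' -> F = F'.
Proof.
move=> e; apply: functor_ext => // f; apply: ordarrow_ext.
- by have /= -> := far_src F f; have /= -> := far_src F' f.
- by have /= -> := far_tgt F f; have /= -> := far_tgt F' f.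
Qed.

Definition ordmap m n (f : 'I_m.+1 -> 'I_n.+1)
  (f_homo : forall i j : 'I_m.+1, i <= j -> f i <= f j) :
  functor (ordcat m) (ordcat n).
Proof.
apply: (@Functor (ordcat m) (ordcat n) f
  (fun a => OrdArrow (f_homo _ _ (oa_le a)))) => //= [x|g h e e'];
  exact: ordarrow_ext.
Defined.

Lemma coface_homo n (i : 'I_n.+2) (j k : 'I_n.+1) : j <= k -> lift i j <= lift i k.
Proof. by rewrite /= leq_bump2. Qed.

Definition coface n (i : 'I_n.+2) : functor (ordcat n) (ordcat n.+1) :=
  ordmap (@coface_homo n i).

Lemma codegen_lt n (i : 'I_n.+1) (j : 'I_n.+2) : unbump i j < n.+1.
Proof. by rewrite /unbump; have := ltn_ord i; have := ltn_ord j; lia. Qed.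

Lemma codegen_homo n (i : 'I_n.+1) (j k : 'I_n.+2) :
  j <= k -> Ordinal (codegen_lt i j) <= Ordinal (codegen_lt i k).
Proof. by rewrite /= /unbump; lia. Qed.

Definition codegen n (i : 'I_n.+1) : functor (ordcat n.+1) (ordcat n) :=
  ordmap (@codegen_homo n i).

(** A simplicial set is given by its faces [d n i : X n.+1 -> X n] and its
    degeneracies [s n i : X n -> X n.+1].  Two embeddings of ordinals are used
    to state the simplicial identities: [inc] keeps the value, [up] adds 1. *)

Definition inc n (i : 'I_n) : 'I_n.+1 := widen_ord (leqnSn n) i.
Definition up n (i : 'I_n) : 'I_n.+1 := lift ord0 i.

Record simplicial (X : nat -> Type)
  (d : forall n, 'I_n.+2 -> X n.+1 -> X n)
  (s : forall n, 'I_n.+1 -> X n -> X n.+1) : Prop := Simplicial {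
  simp_dd : forall n (i j : 'I_n.+2) (x : X n.+2), i <= j ->
    d n i (d n.+1 (up j) x) = d n j (d n.+1 (inc i) x);
  simp_ss : forall n (i j : 'I_n.+1) (x : X n), i <= j ->
    s n.+1 (inc i) (s n j x) = s n.+1 (up j) (s n i x);
  simp_ds_lt : forall n (i : 'I_n.+2) (j : 'I_n.+1) (x : X n.+1), i <= j ->
    d n.+1 (inc i) (s n.+1 (up j) x) = s n j (d n i x);
  simp_ds_inc : forall n (j : 'I_n.+1) (x : X n), d n (inc j) (s n j x) = x;
  simp_ds_up : forall n (j : 'I_n.+1) (x : X n), d n (up j) (s n j x) = x;
  simp_ds_gt : forall n (i : 'I_n.+2) (j : 'I_n.+1) (x : X n.+1), j < i ->
    d n.+1 (up i) (s n.+1 (inc j) x) = s n j (d n i x) }.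

Record sset := SSet {
  simplex :> nat -> Type;
  face : forall n, 'I_n.+2 -> simplex n.+1 -> simplex n;
  degen : forall n, 'I_n.+1 -> simplex n -> simplex n.+1;
  ssetP : simplicial face degen }.

Arguments face {X n} i x : rename.
Arguments degen {X n} i x : rename.

Record smap (X Y : sset) := SMap {
  smap_fun :> forall n, X n -> Y n;
  smap_face : forall n (i : 'I_n.+2) (x : X n.+1),
    smap_fun (face i x) = face i (smap_fun x);
  smap_degen : forall n (i : 'I_n.+1) (x : X n),
    smap_fun (degen i x) = degen i (smap_fun x) }.

Definition sset_isomorphic (X Y : sset) : Prop :=
  exists (f : smap X Y) (g : smap Y X),
    (forall n, cancel (f n) (g n)) /\ (forall n, cancel (g n) (f n)).

(** The [h] operators act on the first index, the [v] operators on the second;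
    [hface] and [hdegen] take the second index first. *)

Record bisset := BiSSet {
  bisimplex :> nat -> nat -> Type;
  hface : forall n m, 'I_m.+2 -> bisimplex m.+1 n -> bisimplex m n;
  hdegen : forall n m, 'I_m.+1 -> bisimplex m n -> bisimplex m.+1 n;
  vface : forall m n, 'I_n.+2 -> bisimplex m n.+1 -> bisimplex m n;
  vdegen : forall m n, 'I_n.+1 -> bisimplex m n -> bisimplex m n.+1;
  bisset_hP : forall n,
    @simplicial (bisimplex^~ n) (@hface n) (@hdegen n);
  bisset_vP : forall m,
    @simplicial (bisimplex m) (@vface m) (@vdegen m);
  hvface : forall m n (i : 'I_m.+2) (j : 'I_n.+2) x,
    hface i (vface j x) = vface j (hface i x);
  hface_vdegen : forall m n (i : 'I_m.+2) (j : 'I_n.+1) x,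
    hface i (vdegen j x) = vdegen j (hface i x);
  hdegen_vface : forall m n (i : 'I_m.+1) (j : 'I_n.+2) x,
    hdegen i (vface j x) = vface j (hdegen i x);
  hvdegen : forall m n (i : 'I_m.+1) (j : 'I_n.+1) x,
    hdegen i (vdegen j x) = vdegen j (hdegen i x) }.

Section Diagonal.
Variable X : bisset.

Let dface n (i : 'I_n.+2) (x : X n.+1 n.+1) : X n n := hface i (vface i x).
Let ddegen n (i : 'I_n.+1) (x : X n n) : X n.+1 n.+1 := hdegen i (vdegen i x).

Lemma diag_simplicial : @simplicial (fun n => X n n) dface ddegen.
Proof.
rewrite /dface /ddegen; split=> n.
- move=> i j x ij; rewrite -!hvface (simp_dd (bisset_hP X n) _ ij).
  by rewrite (simp_dd (bisset_vP X _) _ ij).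
- move=> i j x ij; rewrite -!hvdegen (simp_ss (bisset_hP X _) _ ij).
  by rewrite (simp_ss (bisset_vP X _) _ ij).
- move=> i j x ij; rewrite -hdegen_vface -hface_vdegen.
  by rewrite (simp_ds_lt (bisset_hP X _) _ ij) (simp_ds_lt (bisset_vP X _) _ ij).
- move=> j x; rewrite -hdegen_vface.
  by rewrite (simp_ds_inc (bisset_hP X _)) (simp_ds_inc (bisset_vP X _)).
- move=> j x; rewrite -hdegen_vface.
  by rewrite (simp_ds_up (bisset_hP X _)) (simp_ds_up (bisset_vP X _)).
- move=> i j x ij; rewrite -hdegen_vface -hface_vdegen.
  by rewrite (simp_ds_gt (bisset_hP X _) _ ij) (simp_ds_gt (bisset_vP X _) _ ij).
Qed.

Definition diag : sset := SSet diag_simplicial.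
End Diagonal.

(** A chain c_0 -> ... -> c_n of composable arrows of C is given as a functor
    from {0 < ... < n} to C; lemma [chain_functor] below shows that a
    chain extends to exactly one such functor. *)

Record chain (C : category) n := Chain {
  vertex : 'I_n.+1 -> ob C;
  edge : 'I_n -> ar C;
  edge_src : forall i, src (edge i) = vertex (inc i);
  edge_tgt : forall i, tgt (edge i) = vertex (up i) }.

Lemma step_le n (i : 'I_n) : inc i <= up i.
Proof. by rewrite /= /bump /=; lia. Qed.

Definition step n (i : 'I_n) : ordarrow n := OrdArrow (step_le i).

Lemma functor_step_ext C n (F F' : functor (ordcat n) C) :
  F =1 F' -> (forall i, far F (step i) = far F' (step i)) -> F = F'.
Proof.
move=> obE stE; apply: functor_ext => // -[i j ij].
have [m jE] : exists m, j = i + m :> nat by exists (j - i); lia.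
elim: m j ij jE => [|m IH] j ij jE.
  have ji : j = i by apply: val_inj; rewrite /= jE addn0.
  subst; have -> : OrdArrow ij = @idn (ordcat n) i by exact: ordarrow_ext.
  by rewrite !far_idn obE.
have kn : i + m < n by have := ltn_ord j; lia.
have ik : i <= inc (Ordinal kn) by rewrite /=; lia.
have e : @tgt (ordcat n) (OrdArrow ik) = @src (ordcat n) (step (Ordinal kn)).
  by [].
have -> : OrdArrow ij = @comp (ordcat n) (step (Ordinal kn)) (OrdArrow ik) e.
  by apply: ordarrow_ext; apply: val_inj => //=; rewrite jE /bump /=; lia.
have e1 (H : functor (ordcat n) C) : tgt (far H (OrdArrow ik)) = src (far H (step (Ordinal kn))).
  by rewrite (@far_tgt (ordcat n)) (@far_src (ordcat n)).
by rewrite (far_comp e (e1 F)) (far_comp e (e1 F')); apply: comp_eq; rewrite ?IH.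
Qed.

Section ChainFunctor.
Variables (C : category) (n : nat) (c : chain C n).

Let v k : ob C := vertex c (inord k).
Let e k : ar C := if insub k is Some i then edge c i else idn (v 0).

Fixpoint path_ar i m : ar C :=
  if m is m'.+1 then
    if pselect (tgt (path_ar i m') = src (e (i + m'))) is left p
    then comp (e (i + m')) (path_ar i m') p else idn (v i)
  else idn (v i).

Let e_src k : k < n -> src (e k) = v k.
Proof.
move=> kn; rewrite /e insubT edge_src; congr vertex; apply: val_inj.
by rewrite /= inordK //; lia.
Qed.

Let e_tgt k : k < n -> tgt (e k) = v k.+1.
Proof.
move=> kn; rewrite /e insubT edge_tgt; congr vertex; apply: val_inj.
by rewrite /= inordK //; lia.
Qed.

Lemma path_ends i m : i + m <= n ->
  src (path_ar i m) = v i /\ tgt (path_ar i m) = v (i + m).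
Proof.
elim: m => [|m IH] imn /=; first by rewrite src_idn tgt_idn addn0.
have [|s t] := IH; first by lia.
case: pselect => [p|[]]; last by rewrite t e_src //; lia.
by rewrite src_comp tgt_comp s e_tgt ?addnS //; lia.
Qed.

Lemma path_comp i l m p : i + (l + m) <= n ->
  comp (path_ar (i + l) m) (path_ar i l) p = path_ar i (l + m).
Proof.
elim: m p => [|m IH] /= p ilm.
  rewrite addn0; have [_ t] := @path_ends i l ltac:(lia).
  have q : tgt (path_ar i l) = src (idn (tgt (path_ar i l))) by rewrite src_idn.
  by rewrite -[RHS](comp_idl q); apply: comp_eq; rewrite // t.
move: p; rewrite addnS /= -addnA.
have [sm tm] := @path_ends (i + l) m ltac:(lia).
have [sl tl] := @path_ends i l ltac:(lia).
have [slm tlm] := @path_ends i (l + m) ltac:(lia).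
case: pselect => [q|[]]; last by rewrite tm e_src -?addnA //; lia.
case: pselect => [r|[]]; last by rewrite tlm e_src //; lia.
move=> p; have q' : tgt (path_ar i l) = src (path_ar (i + l) m) by rewrite tl sm.
have r' : tgt (comp (path_ar (i + l) m) (path_ar i l) q') = src (e (i + (l + m))).
  by rewrite tgt_comp q.
rewrite -(comp_assoc r' p); apply: comp_eq => //.
by apply: IH; lia.
Qed.

Lemma chain_functor : exists! F : functor (ordcat n) C,
  (forall i, F i = vertex c i) /\ (forall i, far F (step i) = edge c i).
Proof.
pose a (f : ordarrow n) := path_ar (oa_src f) (oa_tgt f - oa_src f).
have an (f : ordarrow n) : oa_src f + (oa_tgt f - oa_src f) <= n.
  by have := oa_le f; have := ltn_ord (oa_tgt f); lia.
have a_src (f : ordarrow n) : src (a f) = vertex c (oa_src f).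
  by have [-> _] := path_ends (an f); rewrite /v inord_val.
have a_tgt (f : ordarrow n) : tgt (a f) = vertex c (oa_tgt f).
  by have [_ ->] := path_ends (an f); rewrite subnKC ?oa_le // /v inord_val.
have a_idn (i : 'I_n.+1) : a (@idn (ordcat n) i) = idn (vertex c i).
  by rewrite /a /= subnn /= /v inord_val.
have a_comp (g f : ordarrow n) p q :
    a (@comp (ordcat n) g f p) = comp (a g) (a f) q.
  move: p q (an f) (an g); case: g f => [j k jk] [i j' ij] /= p; subst j'.
  rewrite /a /= => q anf ang.
  have -> : k - i = (j - i) + (k - j) by lia.
  have ijE : i + (j - i) = j :> nat by lia.
  have q' : tgt (path_ar i (j - i)) = src (path_ar (i + (j - i)) (k - j)).
    by rewrite ijE.
  rewrite -(@path_comp _ _ _ q'); last by lia.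
  by apply: comp_eq => //; rewrite ijE.
pose F := @Functor (ordcat n) C (vertex c) a a_src a_tgt a_idn a_comp.
have Fstep i : far F (step i) = edge c i.
  rewrite /F /= /a /=; have -> : bump 0 i - i = 1 by rewrite /bump; lia.
  rewrite /= addn0; case: pselect => [p|[]]; last by rewrite tgt_idn e_src.
  have eE : e i = edge c i by rewrite /e valK.
  have q : tgt (idn (src (e i))) = src (e i) by rewrite tgt_idn.
  by rewrite -eE -[RHS](comp_idr q); apply: comp_eq => //; rewrite e_src.
exists F; split=> // F' [F'ob F'st]; apply: functor_step_ext => i.
  by rewrite F'ob.
by rewrite Fstep F'st.
Qed.
End ChainFunctor.

Lemma coface_coface n (i j : 'I_n.+2) : i <= j ->
  fcomp (coface (up j)) (coface i) = fcomp (coface (inc i)) (coface j).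
Proof.
move=> ij; apply: functor_ordcat_ext => k; apply: val_inj.
by rewrite /= /bump /=; lia.
Qed.

Lemma codegen_codegen n (i j : 'I_n.+1) : i <= j ->
  fcomp (codegen j) (codegen (inc i)) = fcomp (codegen i) (codegen (up j)).
Proof.
move=> ij; apply: functor_ordcat_ext => k; apply: val_inj.
by rewrite /= /bump /unbump /=; lia.
Qed.

Lemma codegen_coface_lt n (i : 'I_n.+2) (j : 'I_n.+1) : i <= j ->
  fcomp (codegen (up j)) (coface (inc i)) = fcomp (coface i) (codegen j).
Proof.
move=> ij; apply: functor_ordcat_ext => k; apply: val_inj.
by rewrite /= /bump /unbump /=; lia.
Qed.

Lemma codegen_coface_inc n (j : 'I_n.+1) :
  fcomp (codegen j) (coface (inc j)) = fid (ordcat n).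
Proof.
apply: functor_ordcat_ext => k; apply: val_inj.
by rewrite /= /bump /unbump /=; lia.
Qed.

Lemma codegen_coface_up n (j : 'I_n.+1) :
  fcomp (codegen j) (coface (up j)) = fid (ordcat n).
Proof.
apply: functor_ordcat_ext => k; apply: val_inj.
by rewrite /= /bump /unbump /=; lia.
Qed.

Lemma codegen_coface_gt n (i : 'I_n.+2) (j : 'I_n.+1) : j < i ->
  fcomp (codegen (inc j)) (coface (up i)) = fcomp (coface i) (codegen j).
Proof.
move=> ij; apply: functor_ordcat_ext => k; apply: val_inj.
by rewrite /= /bump /unbump /=; lia.
Qed.

Section Nerve.
Variable C : category.

Let X n := functor (ordcat n) C.
Let d n (i : 'I_n.+2) (F : X n.+1) : X n := fcomp F (coface i).
Let s n (i : 'I_n.+1) (F : X n) : X n.+1 := fcomp F (codegen i).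

Lemma nerve_simplicial : @simplicial X d s.
Proof.
rewrite /d /s; split=> n > => [ij|ij|ij|||ij]; rewrite -!fcompA.
- by rewrite coface_coface.
- by rewrite codegen_codegen.
- by rewrite codegen_coface_lt.
- by rewrite codegen_coface_inc fcompf1.
- by rewrite codegen_coface_up fcompf1.
- by rewrite codegen_coface_gt.
Qed.

Definition nerve : sset := SSet nerve_simplicial.
End Nerve.

Section Fibration.
Variables (E B : category) (p : functor E B).

(** Lifts have a prescribed domain, so this is what is often called
    opcartesian.  The target of h is that of g, by [is_comp h f g]. *)
Definition cartesian (f : ar E) : Prop :=
  forall g, src g = src f -> far p g = far p f ->
  exists! h, far p h = idn (p (tgt f)) /\ is_comp h f g.

Record fibration : Prop := Fibration {
  fib_lift : forall e phi, src phi = p e ->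
    exists f, [/\ cartesian f, src f = e & far p f = phi];
  fib_comp : forall g f e, cartesian g -> cartesian f -> cartesian (comp g f e) }.

Record cleavage (S : ar E -> Prop) : Prop := Cleavage {
  clv_cart : forall f, S f -> cartesian f;
  clv_idn : forall e, S (idn e);
  clv_lift : forall e phi, src phi = p e ->
    exists! f, [/\ S f, src f = e & far p f = phi] }.

Definition closed_cleavage (S : ar E -> Prop) : Prop :=
  cleavage S /\ forall g f e, S g -> S f -> S (comp g f e).

Definition splitting : Prop := fibration /\ exists S, closed_cleavage S.
End Fibration.

Record cleaved_fibration := CleavedFibration {
  total : category;
  base : category;
  proj : functor total base;
  clv : ar total -> Prop;
  fibP : fibration proj;
  clvP : cleavage proj clv }.

Record cleaved_map (E E' : cleaved_fibration) := CleavedMap {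
  cm_total : functor (total E) (total E');
  cm_base : functor (base E) (base E');
  cm_comm : fcomp (proj E') cm_total = fcomp cm_base (proj E);
  cm_cart : forall f, cartesian (proj E) f -> cartesian (proj E') (far cm_total f);
  cm_clv : forall f, clv f -> clv (far cm_total f) }.

Arguments cm_cart {E E'} F {f} _ : rename.
Arguments cm_clv {E E'} F {f} _ : rename.

Lemma cleaved_map_ext E E' (F F' : cleaved_map E E') :
  cm_total F = cm_total F' -> cm_base F = cm_base F' -> F = F'.
Proof.
case: F F' => [t b p1 p2 p3] [t' b' q1 q2 q3] /= tE bE.
by subst; congr CleavedMap; exact: Prop_irrelevance.
Qed.

Section CleavedComp.
Variables (E E' E'' : cleaved_fibration).
Variables (H : cleaved_map E' E'') (F : cleaved_map E E').

Lemma cm_comp_comm :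
  fcomp (proj E'') (fcomp (cm_total H) (cm_total F)) =
  fcomp (fcomp (cm_base H) (cm_base F)) (proj E).
Proof. by rewrite fcompA cm_comm -fcompA cm_comm fcompA. Qed.

Definition cm_comp : cleaved_map E E'' :=
  CleavedMap cm_comp_comm
    (fun f fc => cm_cart H (cm_cart F fc)) (fun f fc => cm_clv H (cm_clv F fc)).
End CleavedComp.

Section Square.
Variables m n : nat.
Local Notation p := (pr2 (ordcat m) (ordcat n)).

Definition square_clv (f : ar (prodcat (ordcat m) (ordcat n))) : Prop :=
  f.1 = idn (src f.1).

Lemma square_cartesianP f : cartesian p f <-> square_clv f.
Proof.
case: f => [[i j ij] [k l kl]]; split => [fc|].
- have [//|//|[h1 h2] [[_ [e hE]] _]] :=
    fc (OrdArrow (leqnn i), OrdArrow kl).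
  apply: ordarrow_ext => //=; apply: val_inj => /=; apply/eqP.
  rewrite eqn_leq ij andbT; have := congr1 (fun f => oa_tgt f.1) hE.
  case: h1 e {hE} => [a b ab] /= [e1 _] bi; subst; exact: ab.
- rewrite /square_clv /= => /(congr1 (@oa_tgt m)) /= ji; subst j.
  move=> [[a b ab] g2] /= [ai gs] gE; subst a g2.
  exists (OrdArrow ab, OrdArrow (leqnn l)); split=> [|[h1 h2] /= [h2E [e hE]]].
    split=> //; exists erefl; rewrite /= /prod_comp.
    by congr pair; exact: ordarrow_ext.
  rewrite h2E; congr pair; have /= hb := congr1 (fun f => oa_tgt f.1) hE.
  by case: (e) => hi _; apply: ordarrow_ext.
Qed.

Lemma square_cleavage : closed_cleavage p square_clv.
Proof.
split; [split|].
- by move=> f /square_cartesianP.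
- by move=> [i k]; rewrite /square_clv.
- move=> [i k] [a b ab] /= ak; subst a.
  exists (OrdArrow (leqnn i), OrdArrow ab); split => [|[f1 f2] [/=]].
    by split.
  by rewrite /square_clv /= => -> [<- _] ->; congr pair; exact: ordarrow_ext.
- move=> [g1 g2] [f1 f2] /= e; rewrite /square_clv /= => gE fE.
  apply: ordarrow_ext => //=; case: (e) => e1 _.
  by rewrite gE /= -e1 fE.
Qed.

Lemma square_fibration : fibration p.
Proof.
have [[sc _ sl] scomp] := square_cleavage; split.
- by move=> e phi /sl [f [[fc fs fp] _]]; exists f; split=> //; exact: sc.
- move=> g f e /square_cartesianP gc /square_cartesianP fc.
  by apply/square_cartesianP; exact: scomp.
Qed.

Definition square : cleaved_fibration :=
  CleavedFibration square_fibration (proj1 square_cleavage).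

Lemma square_cleavage_unique (S : ar (total square) -> Prop) :
  cleavage p S -> forall f, S f <-> square_clv f.
Proof.
move=> [Sc _ Sl] f; split=> [/Sc /square_cartesianP //|fE].
have [//|h [[Sh hs hp] _]] := Sl (src f) f.2.
have hE : square_clv h by apply/square_cartesianP; exact: Sc.
suff -> : f = h by [].
move: hs hp fE hE; rewrite /square_clv; case: f h {Sh} => [f1 f2] [h1 h2] /=.
by move=> [-> _] -> -> ->.
Qed.
End Square.

Section SquareMap.
Variables (m m' n n' : nat).
Variables (a : functor (ordcat m) (ordcat m')) (b : functor (ordcat n) (ordcat n')).

Lemma square_map_comm :
  fcomp (proj (square m' n')) (fprod a b) = fcomp b (proj (square m n)).
Proof. exact: functor_ext. Qed.

Lemma square_map_clv (f : ar (total (square m n))) :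
  square_clv f -> square_clv (far (fprod a b) f).
Proof.
rewrite /square_clv => fE; rewrite [far _ _]/= [fst _]/=.
by rewrite fE (far_idn a) src_idn.
Qed.

Lemma square_map_cart (f : ar (total (square m n))) :
  cartesian (proj (square m n)) f ->
  cartesian (proj (square m' n')) (far (fprod a b) f).
Proof. by move/square_cartesianP => fE; apply/square_cartesianP/square_map_clv. Qed.

Definition square_map : cleaved_map (square m n) (square m' n') :=
  @CleavedMap (square m n) (square m' n') _ _
    square_map_comm square_map_cart square_map_clv.
End SquareMap.

Lemma cm_compA E E' E'' E''' (K : cleaved_map E'' E''') (H : cleaved_map E' E'')
  (F : cleaved_map E E') : cm_comp K (cm_comp H F) = cm_comp (cm_comp K H) F.
Proof. by apply: cleaved_map_ext => /=; rewrite fcompA. Qed.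

Lemma square_map_comp m m' m'' n n' n''
  (a' : functor (ordcat m') (ordcat m'')) (b' : functor (ordcat n') (ordcat n''))
  (a : functor (ordcat m) (ordcat m')) (b : functor (ordcat n) (ordcat n')) :
  cm_comp (square_map a' b') (square_map a b) =
  square_map (fcomp a' a) (fcomp b' b).
Proof. by apply: cleaved_map_ext => //=; apply: functor_ext. Qed.

Lemma cm_comp_square1 E m n (F : cleaved_map (square m n) E) :
  cm_comp F (square_map (fid _) (fid _)) = F.
Proof.
by apply: cleaved_map_ext; apply: functor_ext => //=; case=> x y.
Qed.

Section CleavedNerve.
Variable E : cleaved_fibration.

Let X m n := cleaved_map (square m n) E.
Let hd n m (i : 'I_m.+2) (F : X m.+1 n) : X m n :=
  cm_comp F (square_map (coface i) (fid (ordcat n))).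
Let hs n m (i : 'I_m.+1) (F : X m n) : X m.+1 n :=
  cm_comp F (square_map (codegen i) (fid (ordcat n))).
Let vd m n (i : 'I_n.+2) (F : X m n.+1) : X m n :=
  cm_comp F (square_map (fid (ordcat m)) (coface i)).
Let vs m n (i : 'I_n.+1) (F : X m n) : X m n.+1 :=
  cm_comp F (square_map (fid (ordcat m)) (codegen i)).

Lemma cleaved_nerve_hP n : @simplicial (X^~ n) (@hd n) (@hs n).
Proof.
rewrite /hd /hs; split=> m > => [ij|ij|ij|||ij];
  rewrite -!cm_compA !square_map_comp fcomp1f.
- by rewrite coface_coface.
- by rewrite codegen_codegen.
- by rewrite codegen_coface_lt.
- by rewrite codegen_coface_inc cm_comp_square1.
- by rewrite codegen_coface_up cm_comp_square1.
- by rewrite codegen_coface_gt.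
Qed.

Lemma cleaved_nerve_vP m : @simplicial (X m) (@vd m) (@vs m).
Proof.
rewrite /vd /vs; split=> n > => [ij|ij|ij|||ij];
  rewrite -!cm_compA !square_map_comp fcomp1f.
- by rewrite coface_coface.
- by rewrite codegen_codegen.
- by rewrite codegen_coface_lt.
- by rewrite codegen_coface_inc cm_comp_square1.
- by rewrite codegen_coface_up cm_comp_square1.
- by rewrite codegen_coface_gt.
Qed.

Definition cleaved_nerve : bisset.
Proof.
apply: (@BiSSet X hd hs vd vs cleaved_nerve_hP cleaved_nerve_vP) => m n i j x;
  by rewrite /hd /hs /vd /vs -!cm_compA !square_map_comp !fcomp1f !fcompf1.
Defined.
End CleavedNerve.

Definition delooping (G : groupType) : category.
Proof.
apply: (@Category unit G (fun=> tt) (fun=> tt) (fun=> 1%g)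
  (fun g f _ => (g * f)%g)) => //=.
- by case.
- by case.
- by move=> f _; exact: mul1g.
- by move=> f _; exact: mulg1.
- by move=> h g f _ _ _ _; exact: mulgA.
Defined.

Section Aut.
Variable A : category.

Record aut := Aut {
  aut_fun :> functor A A;
  aut_inv : functor A A;
  aut_funK : fcomp aut_inv aut_fun = fid A;
  aut_invK : fcomp aut_fun aut_inv = fid A }.

Lemma aut_ext (u v : aut) : aut_fun u = aut_fun v -> u = v.
Proof.
case: u v => [f f' p q] [g g' r t] /= fg; subst g.
have e : f' = g' by rewrite -(fcompf1 f') -t fcompA p fcomp1f.
by subst; congr Aut; exact: Prop_irrelevance.
Qed.

Definition aut_one : aut := Aut (fcomp1f (fid A)) (fcomp1f (fid A)).

Lemma aut_mul_funK (u v : aut) :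
  fcomp (fcomp (aut_inv v) (aut_inv u)) (fcomp u v) = fid A.
Proof. by rewrite -fcompA (fcompA (aut_inv u)) aut_funK fcomp1f aut_funK. Qed.

Lemma aut_mul_invK (u v : aut) :
  fcomp (fcomp u v) (fcomp (aut_inv v) (aut_inv u)) = fid A.
Proof. by rewrite -fcompA (fcompA v) aut_invK fcomp1f aut_invK. Qed.

Definition aut_mul (u v : aut) : aut := Aut (aut_mul_funK u v) (aut_mul_invK u v).
Definition aut_V (u : aut) : aut := Aut (aut_invK u) (aut_funK u).

HB.instance Definition _ := gen_eqMixin aut.
HB.instance Definition _ := gen_choiceMixin aut.

Lemma aut_mulA : associative aut_mul.
Proof. by move=> u v w; apply: aut_ext; exact: fcompA. Qed.
Lemma aut_mul1 : left_id aut_one aut_mul.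
Proof. by move=> u; apply: aut_ext; exact: fcomp1f. Qed.
Lemma aut_1mul : right_id aut_one aut_mul.
Proof. by move=> u; apply: aut_ext; exact: fcompf1. Qed.
Lemma aut_mulV : left_inverse aut_one aut_V aut_mul.
Proof. by move=> u; apply: aut_ext; exact: aut_funK. Qed.
Lemma aut_Vmul : right_inverse aut_one aut_V aut_mul.
Proof. by move=> u; apply: aut_ext; exact: aut_invK. Qed.

HB.instance Definition _ :=
  isGroup.Build aut aut_mulA aut_mul1 aut_1mul aut_mulV aut_Vmul.
End Aut.


Definition action (G : groupType) (A : category) := {multiplicative G -> aut A}.

Section Action.
Variables (G : groupType) (A : category) (u : action G A).

Lemma act1 : u 1%g = fid A :> functor A A.
Proof.
suff -> : u 1%g = 1%g by [].
by apply: (mulgI (u 1%g)); rewrite -gmulfM !mulg1.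
Qed.

Lemma actM g h : u (g * h)%g = fcomp (u g) (u h) :> functor A A.
Proof. by rewrite gmulfM. Qed.

(** An arrow x -> x' is a pair of g and of an arrow from u_g(x) to x'; the
    source x is recorded along with the pair, and the target x' is that of
    the arrow of A. *)

Record sdarrow := SdArrow {
  sd_src : ob A;
  sd_grp : G;
  sd_ar : ar A;
  sd_srcE : src sd_ar = u sd_grp sd_src }.

Lemma sdarrow_ext (a b : sdarrow) :
  sd_src a = sd_src b -> sd_grp a = sd_grp b -> sd_ar a = sd_ar b -> a = b.
Proof.
case: a b => [x g f p] [x' g' f' q] /= xE gE fE; subst.
by congr SdArrow; exact: Prop_irrelevance.
Qed.

Definition sd_tgt (a : sdarrow) : ob A := tgt (sd_ar a).

Lemma sd_idn_srcE (x : ob A) : src (idn x) = u 1%g x.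
Proof. by rewrite src_idn act1. Qed.

Definition sd_idn (x : ob A) : sdarrow := SdArrow (sd_idn_srcE x).

Lemma sd_comp_e (b a : sdarrow) : sd_tgt a = sd_src b ->
  tgt (far (u (sd_grp b)) (sd_ar a)) = src (sd_ar b).
Proof. by rewrite far_tgt sd_srcE => <-. Qed.

Lemma sd_comp_srcE (b a : sdarrow) (e : sd_tgt a = sd_src b) :
  src (comp (sd_ar b) (far (u (sd_grp b)) (sd_ar a)) (sd_comp_e e)) =
  u (sd_grp b * sd_grp a)%g (sd_src a).
Proof. by rewrite src_comp far_src sd_srcE actM. Qed.

Definition sd_comp (b a : sdarrow) (e : sd_tgt a = sd_src b) : sdarrow :=
  SdArrow (sd_comp_srcE e).

Definition semidirect : category.
Proof.
apply: (@Category (ob A) sdarrow sd_src sd_tgt sd_idn sd_comp) => //.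
- by move=> x; rewrite /sd_tgt /= tgt_idn.
- by move=> b a e; rewrite /sd_tgt /= tgt_comp.
- move=> a e; apply: sdarrow_ext => //=; first exact: mul1g.
  have aE : far (u 1%g) (sd_ar a) = sd_ar a by rewrite act1.
  rewrite -[RHS](comp_idl (esym (src_idn (tgt (sd_ar a))))).
  exact: comp_eq.
- move=> a e; apply: sdarrow_ext => //=; first exact: mulg1.
  have e1 : tgt (idn (src (sd_ar a))) = src (sd_ar a) by rewrite tgt_idn.
  rewrite -[RHS](comp_idr e1); apply: comp_eq => //.
  by rewrite far_idn sd_srcE.
- move=> c b a e1 e2 e3 e4; apply: sdarrow_ext => //=; first exact: mulgA.
  pose e5 := sd_comp_e e1.
  have e6 : tgt (far (u (sd_grp c)) (far (u (sd_grp b)) (sd_ar a))) =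
      src (far (u (sd_grp c)) (sd_ar b)) by rewrite far_tgt e5 far_src.
  pose e7 := sd_comp_e e3.
  have e8 : tgt (comp (far (u (sd_grp c)) (sd_ar b)) _ e6) = src (sd_ar c).
    by rewrite tgt_comp.
  have e9 : tgt (far (u (sd_grp c)) (far (u (sd_grp b)) (sd_ar a))) =
      src (comp (sd_ar c) (far (u (sd_grp c)) (sd_ar b)) e7) by rewrite src_comp.
  apply: (etrans (comp_eq _ e8 erefl (@far_comp _ _ (u (sd_grp c)) _ _ e5 e6))).
  apply: (etrans (comp_assoc e8 e9)).
  by apply: comp_eq => //; rewrite actM.
Defined.

Definition semidirect_proj : functor semidirect (delooping G).
Proof. exact: (@Functor semidirect (delooping G) (fun=> tt) sd_grp). Defined.

(** The cleavage consists of the arrows (id, g). *)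
Definition semidirect_clv (a : ar semidirect) : Prop :=
  sd_ar a = idn (u (sd_grp a) (sd_src a)).

Lemma sd_is_compP (h a b : ar semidirect) :
  is_comp h a b <->
  [/\ sd_src b = sd_src a, sd_grp b = (sd_grp h * sd_grp a)%g, sd_tgt a = sd_src h
    & is_comp (sd_ar h) (far (u (sd_grp h)) (sd_ar a)) (sd_ar b)].
Proof.
split=> [[e <-]|[sE gE e [e' arE]]]; first by split=> //; exists (sd_comp_e e).
exists e; apply: sdarrow_ext => //=; rewrite -arE; exact: comp_eq.
Qed.

Let opiso (f : ar A) : Prop :=
  forall f2, src f2 = src f -> exists! k, is_comp k f f2.

Lemma opiso_idn x : opiso (idn x).
Proof.
move=> f2; rewrite src_idn => sE.
have e : tgt (idn x) = src f2 by rewrite tgt_idn.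
have kx k (e' : tgt (idn x) = src k) : comp k (idn x) e' = k.
  have xk : x = src k by rewrite -e' tgt_idn.
  by case: _ / (esym xk) e' => e'; exact: comp_idr.
exists f2; split=> [|k [e' <-]]; last by rewrite kx.
by exists e; rewrite kx.
Qed.

Lemma opiso_far g f : opiso f -> opiso (far (u g) f).
Proof.
have uK h v : far (u h^-1%g) (far (u h) v) = v.
  have := actM h^-1%g h; rewrite mulVg act1 => /(congr1 (fun F => far F v)).
  by move=> /= <-.
move=> fP f2 sE; have [|k [[e kE] kU]] := fP (far (u g^-1%g) f2).
  by rewrite far_src sE -far_src uK.
have uVK v : far (u g) (far (u g^-1%g) v) = v by rewrite -{1}[g]invgK uK.
have eg : tgt (far (u g) f) = src (far (u g) k) by rewrite far_tgt e far_src.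
exists (far (u g) k); split.
  by exists eg; rewrite -(far_comp e) kE uVK.
move=> k' [e' k'E]; rewrite -(uVK k'); congr far; apply: kU.
have e2 : tgt f = src (far (u g^-1%g) k').
  by rewrite -(uK g f) far_tgt e' -far_src.
have e3 : tgt (far (u g^-1%g) (far (u g) f)) = src (far (u g^-1%g) k').
  by rewrite uK.
exists e2; rewrite -k'E (far_comp e' e3); apply: comp_eq => //.
Qed.

Lemma opiso_comp f' f e : opiso f' -> opiso f -> opiso (comp f' f e).
Proof.
move=> f'P fP f2; rewrite src_comp => /fP [k1 [[e1 k1E] k1U]].
have [|k [[e2 kE] kU]] := f'P k1; first by rewrite -e1 -e.
have e3 : tgt (comp f' f e) = src k by rewrite tgt_comp.
have e4 : tgt f = src (comp k f' e2) by rewrite src_comp.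
exists k; split.
  exists e3; rewrite (comp_assoc e3 e4) -k1E; exact: comp_eq.
move=> k' [e' k'E]; apply: kU.
have e5 : tgt f' = src k' by rewrite -e' tgt_comp.
have e6 : tgt f = src (comp k' f' e5) by rewrite src_comp.
exists e5; apply: esym; apply: k1U; exists e6.
by rewrite -(comp_assoc e' e6).
Qed.

Lemma semidirect_cartesianP (a : ar semidirect) :
  cartesian semidirect_proj a <-> opiso (sd_ar a).
Proof.
split=> [aC f2 sE|aP b /= sE gE].
- have f2E : src f2 = u (sd_grp a) (sd_src a) by rewrite sE sd_srcE.
  have [//|//|h [[h1 /sd_is_compP [_ _ _ hC]] hU]] := aC (SdArrow f2E).
  exists (sd_ar h); split; first by move: hC; rewrite /= in h1; rewrite h1 act1.
  move=> k [e kE].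
  have ks : src k = u 1%g (sd_tgt a) by rewrite act1.
  rewrite (hU (SdArrow ks)) //; split=> //; apply/sd_is_compP; split=> //=.
    by rewrite mul1g.
  by rewrite act1; exists e.
- have [|k [[e kE] kU]] := aP (sd_ar b); first by rewrite !sd_srcE -sE -gE.
  have ks : src k = u 1%g (sd_tgt a) by rewrite act1.
  exists (SdArrow ks); split.
    split=> //; apply/sd_is_compP; split=> //=; first by rewrite mul1g.
    by rewrite act1; exists e.
  move=> h /= [h1 /sd_is_compP [_ _ ht hC]]; apply: sdarrow_ext => //=.
  by apply: kU; move: hC; rewrite h1 act1.
Qed.

Lemma semidirect_cleavage : closed_cleavage semidirect_proj semidirect_clv.
Proof.
split; [split|].
- by move=> f fE; apply/semidirect_cartesianP; rewrite fE; exact: opiso_idn.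
- by move=> x; rewrite /semidirect_clv /= act1.
- move=> x g _; have gx : src (idn (u g x)) = u g x by rewrite src_idn.
  exists (SdArrow gx); split => [//|a [aE /= sE gE]].
  by apply: sdarrow_ext => //=; rewrite aE sE gE.
- move=> b a e; rewrite /semidirect_clv /= => bE aE.
  have bs : sd_src b = u (sd_grp a) (sd_src a) by rewrite -[LHS]e /= /sd_tgt aE tgt_idn.
  rewrite actM /= -bs; apply: comp_idn => //.
  by rewrite aE far_idn bs.
Qed.

Lemma semidirect_fibration : fibration semidirect_proj.
Proof.
have [[sc _ sl] _] := semidirect_cleavage; split.
- by move=> e phi /sl [f [[fc fs fp] _]]; exists f; split=> //; exact: sc.
- move=> g f e /semidirect_cartesianP gc /semidirect_cartesianP fc.
  by apply/semidirect_cartesianP; apply: opiso_comp => //; exact: opiso_far.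
Qed.

Lemma semidirect_splitting : splitting semidirect_proj.
Proof.
by split; [exact: semidirect_fibration|exists semidirect_clv; exact: semidirect_cleavage].
Qed.

Definition semidirect_fib : cleaved_fibration :=
  CleavedFibration semidirect_fibration (proj1 semidirect_cleavage).

End Action.

Record sgroup := SGroup {
  sgrp :> nat -> groupType;
  sgface : forall n, 'I_n.+2 -> {multiplicative sgrp n.+1 -> sgrp n};
  sgdegen : forall n, 'I_n.+1 -> {multiplicative sgrp n -> sgrp n.+1};
  sgroupP : @simplicial sgrp (fun n i => sgface i) (fun n i => sgdegen i) }.

Arguments sgface {s n} i.
Arguments sgdegen {s n} i.

Record saction (Gam : sgroup) (K : sset) := SAction {
  sact : forall n, Gam n -> K n -> K n;
  sact1 : forall n (x : K n), sact 1%g x = x;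
  sactM : forall n (g h : Gam n) (x : K n), sact (g * h)%g x = sact g (sact h x);
  sact_face : forall n (i : 'I_n.+2) (g : Gam n.+1) (x : K n.+1),
    face i (sact g x) = sact (sgface i g) (face i x);
  sact_degen : forall n (i : 'I_n.+1) (g : Gam n) (x : K n),
    degen i (sact g x) = sact (sgdegen i g) (degen i x) }.

(** The identities for the convention where the twist is on the 0th face and
    the group operates from the left; [tcp_simplicial] shows that they make the
    twisted product a simplicial set. *)
Record twisting (L : sset) (Gam : sgroup) := Twisting {
  tw :> forall n, L n.+1 -> Gam n;
  tw_face0 : forall n (b : L n.+2),
    tw (face (up ord0) b) = (tw (face ord0 b) * sgface ord0 (tw b))%g;
  tw_face : forall n (i : 'I_n.+2) (b : L n.+2), 0 < i ->
    tw (face (up i) b) = sgface i (tw b);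
  tw_degen0 : forall n (b : L n), tw (degen ord0 b) = 1%g;
  tw_degen : forall n (i : 'I_n.+1) (b : L n.+1),
    tw (degen (up i) b) = sgdegen i (tw b) }.

Section TwistedProduct.
Variables (Gam : sgroup) (K L : sset) (act : saction Gam K) (tau : twisting L Gam).

Let X n := (K n * L n)%type.

Let d n (i : 'I_n.+2) (x : X n.+1) : X n :=
  if i == ord0 then (sact act (tau n x.2) (face ord0 x.1), face ord0 x.2)
  else (face i x.1, face i x.2).

Let s n (i : 'I_n.+1) (x : X n) : X n.+1 := (degen i x.1, degen i x.2).

Lemma tcp_simplicial : @simplicial X d s.
Proof.
have up0 m (j : 'I_m) : (up j == ord0) = false by [].
have inc0 m (j : 'I_m.+1) : (inc j == ord0) = (j == ord0) by [].
have incord0 m : inc ord0 = ord0 :> 'I_m.+2 by exact: val_inj.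
have [Kdd Kss Klt Kinc Kup Kgt] := ssetP K.
have [Ldd Lss Llt Linc Lup Lgt] := ssetP L.
rewrite /d /s; split=> n.
- move=> i j [a b] ij; rewrite up0 inc0.
  have [i0|i0] := eqVneq i ord0; last first.
    have [j0|j0] := eqVneq j ord0; last by rewrite /= Kdd ?Ldd.
    by move: ij i0; rewrite j0 leqn0 -val_eqE /= => ->.
  have [j0|j0] := eqVneq j ord0; subst => /=.
    rewrite Kdd // Ldd // incord0; congr pair.
    by rewrite tw_face0 sactM sact_face.
  rewrite Kdd // Ldd // incord0 sact_face tw_face ?lt0n //.
- by move=> i j [a b] ij /=; rewrite Kss ?Lss.
- move=> i j [a b] ij /=; rewrite inc0.
  have [i0|i0] := eqVneq i ord0; last by rewrite /= Klt ?Llt.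
  subst; have := Llt n ord0 j b ij; have := Klt n ord0 j a ij.
  by rewrite incord0 /= => -> ->; rewrite tw_degen sact_degen.
- move=> j [a b] /=; rewrite inc0; have [j0|j0] := eqVneq j ord0; last by rewrite Kinc Linc.
  subst; have := Linc n ord0 b; have := Kinc n ord0 a.
  by rewrite incord0 => -> ->; rewrite tw_degen0 sact1.
- by move=> j [a b] /=; rewrite Kup Lup.
- move=> i j [a b] ij /=.
  have [i0|i0] := eqVneq i ord0; first by rewrite i0 in ij.
  by rewrite /= Kgt ?Lgt.
Qed.

Definition tcp : sset := SSet tcp_simplicial.
End TwistedProduct.

Section NerveAction.
Variables (G : groupType) (A : category) (u : action G A).

Lemma const_simplicial :
  @simplicial (fun=> G) (fun n i => idfun) (fun n i => idfun).
Proof. by []. Qed.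

Definition const_sgroup : sgroup :=
  @SGroup (fun=> G) (fun n i => idfun : {multiplicative G -> G})
    (fun n i => idfun : {multiplicative G -> G}) const_simplicial.

Definition nerve_act n (g : G) (F : nerve A n) : nerve A n := fcomp (u g) F.

Lemma nerve_act1 n (F : nerve A n) : nerve_act 1%g F = F.
Proof. by rewrite /nerve_act act1; exact: fcomp1f. Qed.

Lemma nerve_actM n (g h : G) (F : nerve A n) :
  nerve_act (g * h)%g F = nerve_act g (nerve_act h F).
Proof. by rewrite /nerve_act actM -fcompA. Qed.

Definition nerve_action : saction const_sgroup (nerve A).
Proof.
apply: (@SAction const_sgroup (nerve A) nerve_act nerve_act1 nerve_actM)
  => n i g F; by rewrite /nerve_act /= fcompA.
Defined.
End NerveAction.

(* Main.v *)
Require Import Defs.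
From mathcomp Require Import all_boot.
From mathcomp Require Import zify.
Import Defs.

Set Implicit Arguments.
Unset Strict Implicit.
Unset Printing Implicit Defensive.

(** A cleaved map from the square of sides m and n to the semidirect product is
    a grid of objects with rows indexed by {0 < ... < n}.  Preservation of the
    cleavage forces every vertical arrow of the grid to be some (id, g), so the
    entry in row j is obtained from the entry of row 0 in the same column by the
    action of b(0 -> j), where b is the chain of G that the map covers.  Row 0
    lies over an identity of G, hence is a chain a of A.  Conversely every pair
    (a, b) spreads to such a grid, its row j being the translate of a by
    b(0 -> j).  So the (m, n)-simplices of the cleaved nerve are the pairs
    formed of an m-simplex of NA and an n-simplex of NG ([grid_row0],
    [row0_grid]).

    The bijection commutes with structure maps up to a translation
    ([grid_pullback]): pulling the grid of (a, b) back along (alpha, beta)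
    replaces row 0 by row beta(0), that is, by a alpha translated by
    b(0 -> beta(0)).  A degeneracy or a face other than the 0th fixes the
    vertex 0, so nothing is translated.  The 0th face sends 0 to 1 and
    translates by b(0 -> 1), which is therefore the twisting function.  Its
    only identity with a genuine product is the cocycle relation
    b(0 -> 2) = b(1 -> 2) b(0 -> 1). *)

(** * Composition *)

Lemma comp_idl_eq (C : category) (x : ob C) (g f : ar C) e :
  g = idn x -> comp g f e = f.
Proof.
move=> gE; have e' : tgt f = src (idn (tgt f)) by rewrite src_idn.
rewrite -[RHS](comp_idl e'); apply: comp_eq => //.
by rewrite e gE src_idn.
Qed.

Lemma comp_idr_eq (C : category) (x : ob C) (g f : ar C) e :
  f = idn x -> comp g f e = g.
Proof.
move=> fE; have e' : tgt (idn (src g)) = src g by rewrite tgt_idn.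
rewrite -[RHS](comp_idr e'); apply: comp_eq => //.
by rewrite -e fE tgt_idn.
Qed.

Lemma is_comp_uniq (C : category) (g f k k' : ar C) :
  is_comp g f k -> is_comp g f k' -> k = k'.
Proof. by move=> [e <-] [e' <-]; exact: comp_eq. Qed.

Lemma is_comp_far (C D : category) (F : functor C D) (g f k : ar C) :
  is_comp g f k -> is_comp (far F g) (far F f) (far F k).
Proof.
move=> [e <-]; have e' : tgt (far F f) = src (far F g).
  by rewrite far_src far_tgt e.
by exists e'; rewrite (far_comp e e').
Qed.

(** * Chains of the group *)

Definition from0 n (j : 'I_n.+1) : ordarrow n := OrdArrow (leq0n j : ord0 <= j).

Section Leg.
Variables (G : groupType) (n : nat) (b : functor (ordcat n) (delooping G)).

(** The group element by which row [j] of a grid over [b] is translated from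
    row 0. *)
Definition leg (j : 'I_n.+1) : G := far b (from0 j).

Lemma leg0 : leg ord0 = 1%g.
Proof.
rewrite /leg; have -> : from0 ord0 = @idn (ordcat n) ord0 by exact: ordarrow_ext.
exact: (@far_idn _ _ b).
Qed.

Lemma leg_arrow (f : ordarrow n) :
  leg (oa_tgt f) = (far b f * leg (oa_src f))%g.
Proof.
have e : @tgt (ordcat n) (from0 (oa_src f)) = @src (ordcat n) f by [].
have e' : tgt (far b (from0 (oa_src f))) = src (far b f) by [].
rewrite -[RHS](@far_comp _ _ b _ _ e e') /leg; congr (far b _); exact: ordarrow_ext.
Qed.
End Leg.

Arguments leg : simpl never.

(** The chain [fcomp b beta] starts at the vertex beta(0) of [b], so its legs
    are those of [b] up to the right factor b(0 -> beta(0)); this factor is the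
    source of the twist. *)
Lemma leg_pullback (G : groupType) m n (b : functor (ordcat n) (delooping G))
  (beta : functor (ordcat m) (ordcat n)) (j : 'I_m.+1) :
  (leg (fcomp b beta) j * leg b (beta ord0))%g = leg b (beta j).
Proof.
have /= t := far_tgt beta (from0 j); have /= s := far_src beta (from0 j).
by rewrite -t -s [RHS]leg_arrow.
Qed.

Lemma leg_pullback0 (G : groupType) m n (b : functor (ordcat n) (delooping G))
  (beta : functor (ordcat m) (ordcat n)) (j : 'I_m.+1) :
  beta ord0 = ord0 -> leg (fcomp b beta) j = leg b (beta j).
Proof. by move=> b0; rewrite -leg_pullback b0 leg0 mulg1. Qed.

Section Twist.
Variable G : groupType.

Definition first_arrow n (b : nerve (delooping G) n.+1) : const_sgroup G n :=
  leg b (up ord0).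

(** Both sides are b(0 -> 2), read off the face opposite to the vertex 1 or as
    the composite of b(0 -> 1) and b(1 -> 2). *)
Lemma first_arrow_face0 n (b : nerve (delooping G) n.+2) :
  first_arrow (face (up ord0) b) =
  (first_arrow (face ord0 b) * first_arrow b)%g.
Proof.
rewrite /first_arrow /= leg_pullback0; last exact: val_inj.
have /= -> := leg_pullback b (coface ord0) (up ord0).
by congr leg; exact: val_inj.
Qed.

Lemma first_arrow_face n (i : 'I_n.+2) (b : nerve (delooping G) n.+2) :
  0 < i -> first_arrow (face (up i) b) = first_arrow b.
Proof.
move=> i0; rewrite /first_arrow /= leg_pullback0; last exact: val_inj.
by congr leg; apply: val_inj; rewrite /= /bump /=; lia.
Qed.

Lemma first_arrow_degen0 n (b : nerve (delooping G) n) :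
  first_arrow (degen ord0 b) = 1%g.
Proof.
rewrite /first_arrow /= leg_pullback0; last exact: val_inj.
by rewrite -(leg0 b); congr leg; exact: val_inj.
Qed.

Lemma first_arrow_degen n (i : 'I_n.+1) (b : nerve (delooping G) n.+1) :
  first_arrow (degen (up i) b) = first_arrow b.
Proof.
rewrite /first_arrow /= leg_pullback0; last exact: val_inj.
by congr leg; apply: val_inj; rewrite /= /bump /unbump /=; lia.
Qed.

Definition first_arrow_twisting :
  twisting (nerve (delooping G)) (const_sgroup G) :=
  @Twisting (nerve (delooping G)) (const_sgroup G) first_arrow
    first_arrow_face0 first_arrow_face first_arrow_degen0 first_arrow_degen.
End Twist.

(** * Cleaved maps from a square to the semidirect product *)

Section Grid.
Variables (G : groupType) (A : category) (u : action G A) (m n : nat).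

Section Spread.
Variables (a : functor (ordcat m) A) (b : functor (ordcat n) (delooping G)).

Lemma act_leg (f : ordarrow n) :
  u (leg b (oa_tgt f)) = fcomp (u (far b f)) (u (leg b (oa_src f))) :> functor A A.
Proof. by rewrite leg_arrow actM. Qed.

Lemma spread_srcE (f : ar (prodcat (ordcat m) (ordcat n))) :
  src (far (u (leg b (oa_tgt f.2))) (far a f.1)) =
  u (far b f.2) (u (leg b (oa_src f.2)) (a (oa_src f.1))).
Proof. by rewrite act_leg far_src far_src. Qed.

(** Row j of the grid is the translate of [a] by b(0 -> j).  An arrow that goes
    from row j to row k has group component b(j -> k) and, as component in A,
    the translate of an arrow of [a] by b(0 -> k): that component starts at the
    image of the source under b(j -> k), which already lies in row k. *)
Definition spread : functor (prodcat (ordcat m) (ordcat n)) (semidirect u).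
Proof.
apply: (@Functor (prodcat (ordcat m) (ordcat n)) (semidirect u)
  (fun x => u (leg b x.2) (a x.1)) (fun f => SdArrow (spread_srcE f))) => //=.
- by move=> f; rewrite /sd_tgt /= !far_tgt.
- move=> [i j]; apply: sdarrow_ext => //=.
    exact: (@far_idn _ _ b).
  by rewrite (@far_idn _ _ a) far_idn.
- move=> g f e e'; apply: sdarrow_ext => //=.
    exact: (@far_comp _ _ b g.2 f.2 (congr1 snd e) erefl).
  (* After translation to the row of the target of g, both sides are composites
     of the images of g.1 and f.1. *)
  set k := comp _ _ _; apply: (@is_comp_uniq _ _ _ _ _ _ (ex_intro _ _ erefl)).
  have e2 : oa_tgt f.2 = oa_src g.2 by have [] := e.
  have -> : far (u (far b g.2)) (far (u (leg b (oa_tgt f.2))) (far a f.1)) =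
    far (u (leg b (oa_tgt g.2))) (far a f.1).
    by rewrite e2 (act_leg g.2).
  by do 2! apply: is_comp_far; exists (congr1 fst e).
Defined.

Lemma spread_comm :
  fcomp (semidirect_proj u) spread = fcomp b (pr2 (ordcat m) (ordcat n)).
Proof. by apply: functor_ext => // -[i j] /=; case: (b j). Qed.

Lemma spread_clv (f : ar (total (square m n))) :
  square_clv f -> semidirect_clv (far spread f).
Proof.
rewrite /square_clv /semidirect_clv /= => ->.
by rewrite (@far_idn _ _ a) far_idn act_leg.
Qed.

(** In a square the cartesian arrows are exactly those of the cleavage. *)
Lemma spread_cart (f : ar (total (square m n))) :
  cartesian (proj (square m n)) f -> cartesian (semidirect_proj u) (far spread f).
Proof.
move/square_cartesianP/spread_clv.
exact: (clv_cart (proj1 (semidirect_cleavage u))).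
Qed.

Definition grid : cleaved_nerve (semidirect_fib u) m n :=
  @CleavedMap (square m n) (semidirect_fib u) spread b
    spread_comm spread_cart spread_clv.
End Spread.

Variable F : cleaved_nerve (semidirect_fib u) m n.

Let T : functor (prodcat (ordcat m) (ordcat n)) (semidirect u) := cm_total F.
Let b : functor (ordcat n) (delooping G) := cm_base F.

Lemma grid_grp f : sd_grp (far T f) = far b f.2.
Proof. exact: (congr1 (fun H => far H f) (cm_comm F)). Qed.

Lemma grid_src f : sd_src (far T f) = T (src f).
Proof. exact: (far_src T). Qed.

Lemma grid_tgt f : tgt (sd_ar (far T f)) = T (tgt f).
Proof. exact: (far_tgt T). Qed.

Definition flat (f : ordarrow m) : ar (prodcat (ordcat m) (ordcat n)) :=
  (f, @idn (ordcat n) ord0).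
Definition vert (i : 'I_m.+1) (j : 'I_n.+1) : ar (prodcat (ordcat m) (ordcat n)) :=
  (@idn (ordcat m) i, from0 j).

Lemma grid_flat_grp f : sd_grp (far T (flat f)) = 1%g.
Proof. by rewrite grid_grp; exact: (@far_idn _ _ b). Qed.

Definition row0 : nerve A m.
Proof.
apply: (@Functor (ordcat m) A (fun i => T (i, ord0))
  (fun f => sd_ar (far T (flat f)))).
- by move=> f; rewrite sd_srcE grid_flat_grp act1 grid_src.
- by move=> f; rewrite grid_tgt.
- move=> i; have := far_idn T (i, ord0).
  by move/(congr1 (@sd_ar _ _ _)).
- move=> g f e e'.
  have c : @is_comp (prodcat (ordcat m) (ordcat n))
      (flat g) (flat f) (flat (@comp (ordcat m) g f e)).
    have e2 : @tgt (prodcat (ordcat m) (ordcat n)) (flat f) = src (flat g).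
      by rewrite /= -[oa_tgt f]/(@tgt (ordcat m) f) e.
    by exists e2; congr pair; exact: ordarrow_ext.
  have /sd_is_compP [_ _ _] := is_comp_far T c.
  rewrite grid_flat_grp act1 => cA.
  by apply: is_comp_uniq cA _; exists e'.
Defined.

(** [vert i j] is in the cleavage of the square, hence is sent to an arrow of
    the form (id, g). *)
Lemma grid_vert i j : sd_ar (far T (vert i j)) = idn (u (leg b j) (T (i, ord0))).
Proof.
have c : square_clv (vert i j) by [].
by rewrite (cm_clv F c) grid_grp grid_src.
Qed.

Lemma grid_row0_ob i j : u (leg b j) (T (i, ord0)) = T (i, j).
Proof. by have := grid_tgt (vert i j); rewrite grid_vert tgt_idn. Qed.

(** The diagonal arrow from (i, 0) to (i', k) of the rectangle over 0 -> j -> k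
    factors through (i, j), and also through (i', 0).  In each factorization the
    vertical arrow has an identity of A as component, so the two composites
    express the component of the diagonal in terms of [f] and of row 0. *)
Lemma grid_row0_ar f :
  sd_ar (far T f) = far (u (leg b (oa_tgt f.2))) (far row0 f.1).
Proof.
case: f => f1 f2 /=; pose diagonal := (f1, from0 (oa_tgt f2)).
have c1 : @is_comp (prodcat (ordcat m) (ordcat n))
    (f1, f2) (vert (oa_src f1) (oa_src f2)) diagonal.
  by exists erefl; congr pair; exact: ordarrow_ext.
have c2 : @is_comp (prodcat (ordcat m) (ordcat n))
    (vert (oa_tgt f1) (oa_tgt f2)) (flat f1) diagonal.
  by exists erefl; congr pair; exact: ordarrow_ext.
have /sd_is_compP [_ _ _ [e1 E1]] := is_comp_far T c1.
have /sd_is_compP [_ _ _ [e2 E2]] := is_comp_far T c2.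
rewrite -(comp_idr_eq e1 (etrans (congr1 _ (grid_vert _ _)) (far_idn _ _))).
by rewrite E1 -E2 (comp_idl_eq e2 (grid_vert _ _)) grid_grp.
Qed.

(** A cleaved map is determined by its row 0 and the chain that it covers. *)
Lemma grid_row0 : grid row0 b = F.
Proof.
apply: cleaved_map_ext => //; apply: functor_ext => [[i j]|f].
  exact: grid_row0_ob.
apply: sdarrow_ext; last by rewrite grid_row0_ar.
- by rewrite grid_src -grid_row0_ob.
- by rewrite grid_grp.
Qed.
End Grid.

Lemma row0_grid (G : groupType) (A : category) (u : action G A) m n
  (a : nerve A m) (b : nerve (delooping G) n) : row0 (grid u a b) = a.
Proof.
by apply: functor_ext => i /=; rewrite leg0 act1.
Qed.

(** Row j of the pulled back grid is row beta(j) of the original one; in terms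
    of the new row 0, which is row beta(0), the translation that is left is the
    leg of [fcomp b beta]. *)
Lemma grid_pullback (G : groupType) (A : category) (u : action G A) m n m' n'
    (a : nerve A m) (b : nerve (delooping G) n)
    (alpha : functor (ordcat m') (ordcat m))
    (beta : functor (ordcat n') (ordcat n)) :
  cm_comp (grid u a b) (square_map alpha beta) =
  grid u (fcomp (u (leg b (beta ord0))) (fcomp a alpha)) (fcomp b beta).
Proof.
have legE j : u (leg b (beta j)) =
    fcomp (u (leg (fcomp b beta) j)) (u (leg b (beta ord0))) :> functor A A.
  by rewrite -leg_pullback actM.
apply: cleaved_map_ext => //; apply: functor_ext => [[i j]|f] /=.
  by rewrite legE.
have /= s2 := far_src beta f.2; have /= t2 := far_tgt beta f.2.
have /= s1 := far_src alpha f.1.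
by apply: sdarrow_ext; rewrite //= ?s2 ?t2 ?s1 legE.
Qed.

(** * The isomorphism on diagonals *)

Section Iso.
Variables (G : groupType) (A : category) (u : action G A).

Local Notation D := (diag (cleaved_nerve (semidirect_fib u))).
Local Notation P := (tcp (nerve_action u) (first_arrow_twisting G)).

Definition grid_diag n (x : P n) : D n := grid u x.1 x.2.
Definition row0_diag n (F : D n) : P n := (row0 F, cm_base F).

Lemma grid_diagK n : cancel (@grid_diag n) (@row0_diag n).
Proof. by move=> [a b]; rewrite /row0_diag row0_grid. Qed.

Lemma row0_diagK n : cancel (@row0_diag n) (@grid_diag n).
Proof. by move=> F; exact: grid_row0. Qed.

Lemma diag_face n (i : 'I_n.+2) (F : D n.+1) :
  face i F = cm_comp F (square_map (coface i) (coface i)).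
Proof. by rewrite /= -cm_compA square_map_comp fcomp1f fcompf1. Qed.

Lemma diag_degen n (i : 'I_n.+1) (F : D n) :
  degen i F = cm_comp F (square_map (codegen i) (codegen i)).
Proof. by rewrite /= -cm_compA square_map_comp fcomp1f fcompf1. Qed.

(** For the 0th face, vertex 0 goes to vertex 1, and the translation in
    [grid_pullback] is the value of the twisting function. *)
Lemma grid_face n (i : 'I_n.+2) (x : P n.+1) :
  grid_diag (face i x) = face i (grid_diag x).
Proof.
case: x => a b; rewrite diag_face grid_pullback /=.
have [i0|i0] := eqVneq i ord0; first by rewrite i0.
have -> : lift i ord0 = ord0.
  by apply: val_inj; move: i0; rewrite -val_eqE /= /bump; lia.
by rewrite leg0 act1 fcomp1f.
Qed.

Lemma grid_degen n (i : 'I_n.+1) (x : P n) :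
  grid_diag (degen i x) = degen i (grid_diag x).
Proof.
case: x => a b; rewrite diag_degen grid_pullback /=.
have -> : Ordinal (codegen_lt i ord0) = ord0 by exact: val_inj.
by rewrite leg0 act1 fcomp1f.
Qed.

Definition grid_smap : smap P D := SMap grid_face grid_degen.

Lemma row0_face n (i : 'I_n.+2) (F : D n.+1) :
  row0_diag (face i F) = face i (row0_diag F).
Proof. by rewrite -{1}[F]row0_diagK -grid_face grid_diagK. Qed.

Lemma row0_degen n (i : 'I_n.+1) (F : D n) :
  row0_diag (degen i F) = degen i (row0_diag F).
Proof. by rewrite -{1}[F]row0_diagK -grid_degen grid_diagK. Qed.

Definition row0_smap : smap D P := SMap row0_face row0_degen.
End Iso.

Theorem mainTheorem10 (G : groupType) (A : category) (u : action G A) :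
  exists tau : twisting (nerve (delooping G)) (const_sgroup G),
    sset_isomorphic (diag (cleaved_nerve (semidirect_fib u)))
                    (tcp (nerve_action u) tau).
Proof.
exists (first_arrow_twisting G), (row0_smap u), (grid_smap u).
by split; [exact: row0_diagK|exact: grid_diagK].
Qed.
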